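(* Let $n\geq 0$ and let $(u,v)$ be a Tamari interval diagram of size $n$. Then $(u,v)$ is synchronized if and only if $\rho(\chi(u,v))$ is a synchronized Tamari interval.
   Context: For integers $i,j$, $[i,j]=\{i,i+1,\dots,j\}$ and $[i]=[1,i]$. A Tamari diagram of size $n$ is a word $u$ of length $n$ on $\mathbb{N}=\{0,1,2,\dots\}$ such that $0\leq u_i\leq n-i$ for all $i\in[n]$ and $u_{i+j}\leq u_i-j$ for all $i\in[n]$, $j\in[0,u_i]$. A dual Tamari diagram of size $n$ is a word $v$ of length $n$ on $\mathbb{N}$ such that $0\leq v_i\leq i-1$ for all $i\in[n]$ and $v_{i-j}\leq v_i-j$ for all $i\in[n]$, $j\in[0,v_i]$. They are compatible if there are no $1\leq i<j\leq n$ with $u_i\geq j-i$ and $v_j\geq j-i$. A Tamari interval diagram of size $n$ is a pair $(u,v)$ of compatible Tamari and dual Tamari diagrams of size $n$. It is synchronized if $u_i\neq 0$ or $v_{i+1}\neq 0$ for every $i\in[n-1]$. An interval-poset of size $n$ is a partial order $\lhd$ on $\{\pi_1,\dots,\pi_n\}$ such that for $i<j<k$: $\pi_k\lhd\pi_i$ implies $\pi_j\lhd\pi_i$, and $\pi_i\lhd\pi_k$ implies $\pi_j\lhd\pi_k$. The bijection $\chi$ sends a Tamari interval diagram $(u,v)$ of size $n$ to the interval-poset whose relations are $\pi_{i+l}\lhd\pi_i$ for $i\in[n]$, $0\leq l\leq u_i$, and $\pi_{i-k}\lhd\pi_i$ for $i\in[n]$, $0\leq k\leq v_i$. A binary tree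 is either a leaf or a node attached to two binary trees, its left and right subtrees; its size is its number of nodes, which are numbered $1,\dots,n$ in infix order (recursively: left subtree, root, right subtree). The Tamari order $\preccurlyeq_{\mathsf{ta}}$ on binary trees of size $n$ is the reflexive-transitive closure of right rotation, which locally replaces a configuration $((\mathfrak a,\mathfrak b),\mathfrak c)$ by $(\mathfrak a,(\mathfrak b,\mathfrak c))$. A Tamari interval of size $n$ is a pair $(\mathfrak s,\mathfrak t)$ of binary trees of size $n$ with $\mathfrak s\preccurlyeq_{\mathsf{ta}}\mathfrak t$. The (known, due to Châtel and Pons) bijection $\rho$ sends an interval-poset of size $n$ to the Tamari interval $(\mathfrak s,\mathfrak t)$ where $\mathfrak s$ is the unique binary tree such that, for all $i<j$, node $j$ lies in the right subtree of node $i$ if and only if $\pi_j\lhd\pi_i$, and $\mathfrak t$ is the unique binary tree such that, for all $i<j$, node $i$ lies in the left subtree of node $j$ if and only if $\pi_i\lhd\pi_j$. The canopy of a binary tree of size $n\geq 1$ is the word of length $n-1$ on $\{0,1\}$ obtained by labeling each leaf that is a left (resp. right) child by $0$ (resp. $1$), reading the labels of the $n+1$ leaves from left to right, and forgetting the first and the last one. (For $n=0$ the canopy is taken to be the empty word.) A Tamari interval $(\mathfrak s,\mathfrak t)$ is synchronized if $\mathfrak s$ and $\mathfrak t$ have the same canopy. *)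

(* Defs.v *)
From Stdlib Require Import Relation_Operators ClassicalEpsilon.
From mathcomp Require Import all_boot zify.

Set Implicit Arguments.
Unset Strict Implicit.
Unset Printing Implicit Defensive.

(* Letters, poset elements and tree nodes are all numbered from 1, as natural
   numbers; [1, n] is made explicit wherever it matters. *)

(* Only meaningful for 1 <= i <= size w. *)
Definition letter (w : seq nat) (i : nat) : nat := nth 0 w i.-1.

Definition tamari_diagram n (u : n.-tuple nat) : Prop :=
  (forall i, 1 <= i <= n -> letter u i <= n - i) /\
  (forall i j, 1 <= i <= n -> j <= letter u i ->
     letter u (i + j) <= letter u i - j).

Definition dual_tamari_diagram n (v : n.-tuple nat) : Prop :=
  (forall i, 1 <= i <= n -> letter v i <= i - 1) /\
  (forall i j, 1 <= i <= n -> j <= letter v i ->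
     letter v (i - j) <= letter v i - j).

Definition compatible n (u v : n.-tuple nat) : Prop :=
  ~ exists i j, [/\ 1 <= i, i < j, j <= n,
                    j - i <= letter u i & j - i <= letter v j].

Definition tamari_interval_diagram n (u v : n.-tuple nat) : Prop :=
  [/\ tamari_diagram u, dual_tamari_diagram v & compatible u v].

Definition synchronized_diagram n (u v : n.-tuple nat) : Prop :=
  forall i, 1 <= i <= n - 1 -> letter u i <> 0 \/ letter v (i + 1) <> 0.

(* [ip_rel a b] stands for pi_a <| pi_b. *)
Record interval_poset (n : nat) := IntervalPoset {
  ip_rel :> rel nat;
  ip_supp : forall a b, ip_rel a b -> (1 <= a <= n) && (1 <= b <= n);
  ip_refl : forall a, 1 <= a <= n -> ip_rel a a;
  ip_anti : antisymmetric ip_rel;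
  ip_trans : transitive ip_rel;
  ip_decr : forall i j k, 1 <= i -> i < j -> j < k -> k <= n ->
    ip_rel k i -> ip_rel j i;
  ip_incr : forall i j k, 1 <= i -> i < j -> j < k -> k <= n ->
    ip_rel i k -> ip_rel j k
}.

Definition chi_rel n (u v : n.-tuple nat) : rel nat := fun a b =>
  (1 <= b <= n) &&
  ((b <= a <= b + letter u b) || (b - letter v b <= a <= b)).

Lemma chi_supp n (u v : n.-tuple nat) a b :
  tamari_interval_diagram u v ->
  chi_rel u v a b -> (1 <= a <= n) && (1 <= b <= n).
Proof.
case=> -[hu _] [hv _] _ /andP[hb hab].
by have := hu b hb; have := hv b hb; lia.
Qed.

Lemma chi_refl n (u v : n.-tuple nat) a :
  1 <= a <= n -> chi_rel u v a a.
Proof. by rewrite /chi_rel => ->; lia. Qed.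

Lemma chi_anti n (u v : n.-tuple nat) :
  tamari_interval_diagram u v -> antisymmetric (chi_rel u v).
Proof.
move=> huv a b /andP[hab hba].
have hc i j : i < j -> chi_rel u v i j -> chi_rel u v j i -> False.
  move=> ij /andP[hj hij] /andP[hi hji]; case: huv => _ _; apply.
  by exists i, j; split; lia.
by case: (ltngtP a b) => // h; case: (hc _ _ h).
Qed.

Lemma chi_trans n (u v : n.-tuple nat) :
  tamari_interval_diagram u v -> transitive (chi_rel u v).
Proof.
move=> huv b a c hab hbc.
have /andP[ha hb] := chi_supp huv hab; have /andP[_ hc] := chi_supp huv hbc.
case: huv => -[hu hu'] [hv hv'] huvc.
move: hab hbc; rewrite /chi_rel hb hc /= => hab hbc.
have [cb | bc] := leqP c b.
  have hd : b - c <= letter u c by lia.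
  have := hu' c (b - c) hc hd; rewrite subnKC // => hub.
  have [ba | ab] := leqP b a; first by lia.
  have [ca | ac] := leqP c a; first by lia.
  case: (ltnP c b) => [ltcb | lebc].
    by case: huvc; exists c, b; split; lia.
  by have ebc : b = c; [lia | subst b; lia].
have hd : c - b <= letter v c by lia.
have := hv' c (c - b) hc hd; rewrite subKn; last by lia.
move=> hvb; have [ab | ba] := leqP a b; first by lia.
have [ac | ca] := leqP a c; first by lia.
by case: huvc; exists b, c; split; lia.
Qed.

Lemma chi_decr n (u v : n.-tuple nat) i j k :
  1 <= i -> i < j -> j < k -> k <= n ->
  chi_rel u v k i -> chi_rel u v j i.
Proof. by rewrite /chi_rel; lia. Qed.

Lemma chi_incr n (u v : n.-tuple nat) i j k :
  1 <= i -> i < j -> j < k -> k <= n ->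
  chi_rel u v i k -> chi_rel u v j k.
Proof. by rewrite /chi_rel; lia. Qed.

Definition chi n (u v : n.-tuple nat)
    (huv : tamari_interval_diagram u v) : interval_poset n :=
  @IntervalPoset n (chi_rel u v) (fun a b => chi_supp huv)
    (@chi_refl n u v) (chi_anti huv) (chi_trans huv)
    (@chi_decr n u v) (@chi_incr n u v).

Inductive btree : Type := Leaf | Node of btree & btree.

Fixpoint tsize (t : btree) : nat :=
  if t is Node l r then tsize l + 1 + tsize r else 0.

(* [in_right t i j]: in the infix numbering of t, node j lies in the right
   subtree of node i.  The root of [Node l r] is numbered [tsize l + 1], and
   the numbering of r is shifted by that amount; false if i or j is not the
   number of a node. *)
Fixpoint in_right (t : btree) (i j : nat) : bool :=
  if t is Node l r then
    let k := tsize l + 1 in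
    if i < k then in_right l i j
    else if i == k then k < j <= k + tsize r
    else in_right r (i - k) (j - k)
  else false.

(* [in_left t j i]: node i lies in the left subtree of node j. *)
Fixpoint in_left (t : btree) (j i : nat) : bool :=
  if t is Node l r then
    let k := tsize l + 1 in
    if j < k then in_left l j i
    else if j == k then 1 <= i < k
    else in_left r (j - k) (i - k)
  else false.

Inductive right_rotation : btree -> btree -> Prop :=
| RotRoot a b c : right_rotation (Node (Node a b) c) (Node a (Node b c))
| RotLeft l l' r : right_rotation l l' -> right_rotation (Node l r) (Node l' r)
| RotRight l r r' :
    right_rotation r r' -> right_rotation (Node l r) (Node l r').

Definition tamari_le : btree -> btree -> Prop :=
  clos_refl_trans btree right_rotation.

Definition tamari_interval (n : nat) (st : btree * btree) : Prop :=
  [/\ tsize st.1 = n, tsize st.2 = n & tamari_le st.1 st.2].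

Definition rho_lower n (P : interval_poset n) (s : btree) : Prop :=
  tsize s = n /\
  forall i j, 1 <= i -> i < j -> j <= n -> (in_right s i j <-> P j i).

Definition rho_upper n (P : interval_poset n) (t : btree) : Prop :=
  tsize t = n /\
  forall i j, 1 <= i -> i < j -> j <= n -> (in_left t j i <-> P i j).

(* Each component is the unique tree with the given property; [Leaf] only
   witnesses that [btree] is inhabited. *)
Definition rho n (P : interval_poset n) : btree * btree :=
  (epsilon (inhabits Leaf) (rho_lower P),
   epsilon (inhabits Leaf) (rho_upper P)).

(* Labels of the leaves from left to right, [false] (0) for a left child and
   [true] (1) for a right child; b is the label used if t itself is a leaf. *)
Fixpoint leaf_labels (b : bool) (t : btree) : seq bool :=
  if t is Node l r then leaf_labels false l ++ leaf_labels true r else [:: b].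

(* The label given to [Leaf] at top level is dropped, so the choice of [false]
   is irrelevant. *)
Definition canopy (t : btree) : seq bool :=
  let w := leaf_labels false t in behead (take (size w).-1 w).

Definition synchronized_interval (n : nat) (st : btree * btree) : Prop :=
  tamari_interval n st /\ canopy st.1 = canopy st.2.

(* Main.v *)
From Stdlib Require Import Relation_Operators ClassicalEpsilon.
From mathcomp Require Import all_boot zify.
Require Import Defs.

(** Everything is read off from the two relations in_right and in_left of a
    tree.

    Bit i of the canopy of a tree is the label of the leaf between nodes i and
    i + 1. One of these two nodes is always an ancestor of the other: either
    i + 1 lies in the right subtree of i, and the leaf is the left child of
    i + 1, or i lies in the left subtree of i + 1, and the leaf is the right
    child of i ([nth_canopy], [in_left_succ]). Let s and t be the two components
    of the image of (u, v). Bit i of the canopy of s is thus 1 exactly when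
    u_i = 0, and bit i of the canopy of t is 1 exactly when v_(i+1) <> 0. Equal
    canopies mean that exactly one of u_i and v_(i+1) is nonzero for each i.
    Compatibility, applied to the pair (i, i + 1), forbids both from being
    nonzero, so what remains is the definition of a synchronized diagram.

    As rho is given by a choice operator, the characteristic properties of s
    and t are available only once trees with these properties are known to
    exist. Such a tree is built from its word of right subtree sizes: the root
    must be the least i whose right subtree reaches the last node, and the
    diagram conditions pass to both sides of the root ([bracket_tree]). Dual
    diagrams follow by mirror symmetry ([dual_bracket_tree]).

    A synchronized interval must also satisfy s <= t in the Tamari order.
    Compatibility says that no pair i < j has both j in the right subtree of i
    in s and i in the left subtree of j in t. This forces the in_right relation
    of s to be contained in that of t ([tamari_le_of_compatible]), and this
    containment suffices: the node of s numbered like the root of t lies on the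
    left spine of s, so right rotations lift it to the root, and one recurses
    into both subtrees ([rotate_to_root], [tamari_le_of_in_right]). *)

(** * Descendants in a binary tree *)

Lemma in_right_bounds t i j : in_right t i j -> (0 < i < j) && (j <= tsize t).
Proof.
elim: t i j => [|l IHl r IHr] i j //=.
case: ltnP => hi; first by move=> /IHl; lia.
by case: eqP => hk; [lia | move=> /IHr; lia].
Qed.

Lemma in_right_interval t i k j : i < k < j -> in_right t i j -> in_right t i k.
Proof.
elim: t i k j => [|l IHl r IHr] i k j //= hk.
case: ltnP => hi; first exact: IHl.
case: eqP => [hik | ne]; first by lia.
move=> h; have hb := in_right_bounds _ _ _ h.
by apply: IHr h; lia.
Qed.

Lemma in_left_bounds t j i : in_left t j i -> (0 < i < j) && (j <= tsize t).
Proof.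
elim: t i j => [|l IHl r IHr] i j //=.
case: ltnP => hi; first by move=> /IHl; lia.
by case: eqP => hk; [lia | move=> /IHr; lia].
Qed.

Lemma in_rightNin_left t i j : in_right t i j -> ~~ in_left t j i.
Proof.
elim: t i j => [|l IHl r IHr] i j //=.
case: ltnP => hi.
  move=> h; have hb := in_right_bounds _ _ _ h.
  by rewrite ifT; [exact: IHl | lia].
case: eqP => hk.
  move=> hj; rewrite !ifN; try lia.
  by apply/negP => /in_left_bounds; lia.
move=> h; have hb := in_right_bounds _ _ _ h.
by rewrite !ifN; [exact: IHr | lia | lia].
Qed.

(** When neither of i < j is an ancestor of the other, their lowest common
    ancestor lies strictly between them in infix order. *)
Lemma unrelated_separated t i j : 0 < i < j -> j <= tsize t ->
  ~~ in_right t i j -> ~~ in_left t j i ->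
  exists k, i < k < j /\ in_left t k i.
Proof.
elim: t i j => [|l IHl r IHr] i j /=; first by lia.
set k := tsize l + 1 => hij hj.
case: (ltngtP i k) => hi /=; case: (ltngtP j k) => hjk /=; try lia.
- move=> h1 h2; case: (IHl i j) => //; first by lia.
  by move=> m [hm hm']; exists m; split=> //; rewrite ifT; lia.
- by move=> _ _; exists k; rewrite ltnn eqxx; lia.
- move=> h1 h2; case: (IHr (i - k) (j - k)) => //; try lia.
  move=> m [hm hm']; exists (m + k); split; first by lia.
  by rewrite !ifN ?addnK //; lia.
Qed.

(** No node can separate two consecutive ones, so one is an ancestor of the
    other. *)
Lemma in_left_succ t i : 0 < i < tsize t ->
  in_left t i.+1 i = ~~ in_right t i i.+1.
Proof.
move=> hi; apply/idP/idP; first by apply: contraL; exact: in_rightNin_left.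
move=> h; apply/negPn/negP => h'.
by have [|//|//|//|k [hk _]] := unrelated_separated t i i.+1; lia.
Qed.

(** * Canopies *)

Lemma size_leaf_labels b t : size (leaf_labels b t) = (tsize t).+1.
Proof. by elim: t b => //= l IHl r IHr b; rewrite size_cat IHl IHr; lia. Qed.

(** The two extreme leaves are covered as well: i = 0 is singled out by the
    factor [0 < i], and at i = tsize t there is no node i.+1, whence the label
    1. Covering them lets the induction go through, since the last leaf of the
    left subtree and the first leaf of the right one are inner leaves of the
    whole tree. *)
Lemma nth_leaf_labels b t i : 0 < tsize t -> i <= tsize t ->
  nth false (leaf_labels b t) i = (0 < i) && ~~ in_right t i i.+1.
Proof.
elim: t b i => [|l IHl r IHr] b i //= _ hi.
rewrite nth_cat size_leaf_labels ltnS addn1 ltnS.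
case: (leqP i (tsize l)) => il.
  case: l IHl il {hi} => [|ll lr] IHl il; first by case: i il.
  by rewrite IHl //=; lia.
case: eqP => [-> | ne].
  rewrite subnn; case: r IHr {hi} => [|rl rr] IHr; first by rewrite /=; lia.
  by rewrite IHr //=; lia.
by rewrite IHr; [rewrite subSn //; lia | lia | lia].
Qed.

Lemma size_canopy t : size (canopy t) = (tsize t).-1.
Proof. by rewrite size_behead size_take size_leaf_labels ltnSn. Qed.

Lemma nth_canopy t i : 0 < i < tsize t ->
  nth false (canopy t) i.-1 = ~~ in_right t i i.+1.
Proof.
move=> hi; rewrite /canopy size_leaf_labels nth_behead prednK; last by lia.
by rewrite nth_take ?nth_leaf_labels //; lia.
Qed.

Lemma canopy_eqP s t : tsize s = tsize t ->
  canopy s = canopy t <->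
  forall i, 0 < i < tsize t -> ~~ in_right s i i.+1 = in_left t i.+1 i.
Proof.
move=> hst; split=> [e i hi | h].
  by rewrite in_left_succ // -!nth_canopy ?e // hst.
apply: (@eq_from_nth _ false); rewrite !size_canopy hst // => i hi.
by rewrite -[i]/i.+1.-1 !nth_canopy ?h ?in_left_succ //; lia.
Qed.

(** * Trees with prescribed subtree sizes *)

(** The right subtree of the root ends at node n, while that of a smaller node
    stops before the root. So the root can only be the least k with
    k + f k = n. *)
Lemma bracket_tree n (f : nat -> nat) :
  (forall i, 0 < i <= n -> i + f i <= n) ->
  (forall i j, 0 < i <= n -> j <= f i -> f (i + j) + j <= f i) ->
  exists2 t, tsize t = n &
    forall i j, 0 < i <= n -> in_right t i j = (i < j <= i + f i).
Proof.
elim/ltn_ind: n f => -[|n] IH f hb hf; first by exists Leaf => // i j; lia.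
have ex : exists k, (0 < k) && (k + f k == n.+1).
  by exists n.+1; have := hb n.+1; lia.
case: (ex_minnP ex) => k /andP[k0 /eqP kn] kmin.
(* A right subtree starting before k and reaching k would contain that of k,
   hence reach n.+1 and contradict the minimality of k. *)
have left_lt i : 0 < i < k -> i + f i < k.
  move=> hi; rewrite ltnNge; apply/negP => hk.
  have := hf i (k - i); rewrite subnKC; last by lia.
  by have := kmin i; have := hb i; lia.
have [|||l sl hl] := IH k.-1 _ f.
- by lia.
- by move=> i hi; have := left_lt i; lia.
- by move=> i j hi; apply: hf; lia.
have [|||r sr hr] := IH (n.+1 - k) _ (fun i => f (i + k)).
- by lia.
- by move=> i hi; have := hb (i + k); lia.
- by move=> i j hi; rewrite addnAC; apply: hf; lia.
exists (Node l r) => [|i j hi] /=; first by lia.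
rewrite sl sr addn1 prednK //.
case: ltnP => ik; first by rewrite hl //; lia.
case: eqP => [-> | ne]; first by lia.
by rewrite hr ?subnK //; lia.
Qed.

Fixpoint mirror (t : btree) : btree :=
  if t is Node l r then Node (mirror r) (mirror l) else Leaf.

Lemma tsize_mirror t : tsize (mirror t) = tsize t.
Proof. by elim: t => //= l -> r ->; lia. Qed.

Lemma in_left_mirror t i j : 0 < i < j -> j <= tsize t ->
  in_left (mirror t) j i = in_right t (tsize t + 1 - j) (tsize t + 1 - i).
Proof.
elim: t i j => [|l IHl r IHr] i j /=; first by lia.
rewrite tsize_mirror => hij hj.
case: ltnP => [h | h].
  rewrite IHr //; last by lia.
  by rewrite !ifN; [congr in_right; lia | lia | lia].
case: eqP => [-> | ne].
  by rewrite ifN ?ifT; lia.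
(* Now j is beyond the root of the mirror image. Unless i is beyond it too, i
   is not below j and both sides are false. *)
rewrite ifT; last by lia.
have [hi | hi] := ltnP (tsize r + 1) i.
  by rewrite IHl; [congr in_right | |]; lia.
by apply/idP/idP => [/in_left_bounds | /in_right_bounds]; lia.
Qed.

(** Reversing a dual diagram gives a diagram, and mirroring a tree exchanges
    left and right subtrees while reversing the infix numbering. *)
Lemma dual_bracket_tree n (g : nat -> nat) :
  (forall i, 0 < i <= n -> g i < i) ->
  (forall i j, 0 < i <= n -> j <= g i -> g (i - j) + j <= g i) ->
  exists2 t, tsize t = n &
    forall i j, 0 < i < j -> j <= n -> in_left t j i = (j - g j <= i).
Proof.
move=> hb hg.
have [||t st ht] := bracket_tree n (fun i => g (n + 1 - i)).
- by move=> i hi; have := hb (n + 1 - i); lia.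
- by move=> i j hi hj; rewrite subnDA; apply: hg; lia.
exists (mirror t) => [|i j hij hj]; first by rewrite tsize_mirror.
rewrite in_left_mirror ?st // ht; last by lia.
by rewrite subKn; last lia; have := hb j; lia.
Qed.

(** * Comparison in the Tamari order *)

Lemma tamari_le_left l l' r :
  tamari_le l l' -> tamari_le (Node l r) (Node l' r).
Proof.
elim=> [x y h | x | x y z _ h1 _ h2]; last exact: rt_trans h1 h2.
- by apply/rt_step/RotLeft.
- exact: rt_refl.
Qed.

Lemma tamari_le_right l r r' :
  tamari_le r r' -> tamari_le (Node l r) (Node l r').
Proof.
elim=> [x y h | x | x y z _ h1 _ h2]; last exact: rt_trans h1 h2.
- by apply/rt_step/RotRight.
- exact: rt_refl.
Qed.

(** The hypothesis on k says that the path from the root to k never goes right,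
    so k is on the left spine. Rotating k with each of its ancestors in turn
    brings it to the root, and each such rotation enlarges the right subtree of
    k while leaving those of all other nodes unchanged. *)
Lemma rotate_to_root s k : 0 < k <= tsize s ->
  (forall i, ~~ in_right s i k) ->
  exists a c, [/\ tamari_le s (Node a c), tsize a + 1 = k,
    tsize (Node a c) = tsize s &
    forall i j, i != k -> in_right (Node a c) i j = in_right s i j].
Proof.
elim: s => [|l IHl r _] /=; first by lia.
case: (ltngtP k (tsize l + 1)) => [kl hk hin | kr hk hin | -> _ _].
- case: IHl; first by lia.
    move=> i; have := hin i; case: ltnP => // hi _.
    by apply/negP => /in_right_bounds; lia.
  move=> a [c [le sa /= sl hac]]; exists a, (Node c r); split=> //=; try lia.
    by apply: rt_trans (tamari_le_left _ _ r le) _; apply/rt_step/RotRoot.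
  move=> i j ik; have := hac i j ik; rewrite sa (negbTE ik).
  case: (ltnP i k) => hi; first by rewrite ifT //; lia.
  have -> : (i - k < tsize c + 1) = (i < tsize l + 1) by lia.
  have -> : (i - k == tsize c + 1) = (i == tsize l + 1) by lia.
  rewrite -!subnDA; have -> : k + (tsize c + 1) = tsize l + 1 by lia.
  by case: (ltnP i (tsize l + 1)) => // hil _; case: eqP => // _; lia.
- have := hin (tsize l + 1); rewrite ltnn eqxx; lia.
- by exists l, r; split=> //; exact: rt_refl.
Qed.

(** After the root k of t has been rotated to the root of s, the containment
    survives: only the right subtree of k has changed, and in t it consists of
    all nodes beyond k. It then restricts to the left and right subtrees. *)
Lemma tamari_le_of_in_right s t : tsize s = tsize t ->
  (forall i j, in_right s i j -> in_right t i j) -> tamari_le s t.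
Proof.
elim: t s => [|l IHl r IHr] s hst sub.
  by case: s hst {sub} => [|a c] /=; [move=> _; exact: rt_refl | lia].
have [||a [c [le sa ss hac]]] := rotate_to_root s (tsize l + 1).
- by rewrite hst /=; lia.
- move=> i; apply/negP => /[dup] /in_right_bounds hi /sub /=.
  by case: ltnP; [move=> _ /in_right_bounds | case: eqP]; lia.
have sl : tsize a = tsize l by lia.
have sr : tsize c = tsize r by rewrite hst /= in ss; lia.
have sub' i j : i != tsize l + 1 ->
    in_right (Node a c) i j -> in_right (Node l r) i j.
  by move=> hi; rewrite hac //; exact: sub.
apply: rt_trans le _; apply: (rt_trans _ _ _ (Node l c)).
  apply/tamari_le_left/IHl => // i j h; have hb := in_right_bounds _ _ _ h.
  by have := sub' i j; rewrite /= sl !ifT; [apply=> //; lia | lia | lia].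
apply/tamari_le_right/IHr => // i j h; have hb := in_right_bounds _ _ _ h.
have := sub' (i + (tsize l + 1)) (j + (tsize l + 1)).
by rewrite /= sl !addnK !ifN; [apply=> //; lia | lia | lia | lia | lia].
Qed.

(** If j is in the right subtree of i in s but not in t, the lowest common
    ancestor k of i and j in t lies strictly between them: k is then in the
    right subtree of i in s, while i is in the left subtree of k in t. *)
Lemma tamari_le_of_compatible s t : tsize s = tsize t ->
  (forall i j, in_right s i j -> ~~ in_left t j i) ->
  tamari_le s t.
Proof.
move=> hst hc; apply: tamari_le_of_in_right => // i j h.
apply/negPn/negP => hn; have := in_right_bounds _ _ _ h => hb.
case: (unrelated_separated t i j) => [|||| k [hk]] //;
  [lia | lia | exact: hc |].
by apply/negP/hc/(in_right_interval _ _ _ _ hk).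
Qed.

(** * The trees attached to a diagram *)

Lemma rho_lower_ex n (u v : n.-tuple nat) (huv : tamari_interval_diagram u v) :
  exists s, rho_lower (chi huv) s.
Proof.
have [[hb hu] _ _] := huv.
have [||s ss hs] := bracket_tree n (letter u).
- by move=> i hi; have := hb i hi; lia.
- by move=> i j hi hj; have := hu i j hi hj; lia.
by exists s; split=> // i j i0 ij jn; rewrite hs /= /chi_rel; lia.
Qed.

Lemma rho_upper_ex n (u v : n.-tuple nat) (huv : tamari_interval_diagram u v) :
  exists t, rho_upper (chi huv) t.
Proof.
have [_ [hb hv] _] := huv.
have [||t st ht] := dual_bracket_tree n (letter v).
- by move=> i hi; have := hb i hi; lia.
- by move=> i j hi hj; have := hv i j hi hj; lia.
by exists t; split=> // i j i0 ij jn; rewrite ht /= /chi_rel; lia.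
Qed.

Theorem proposition2p3p3 (n : nat) (u v : n.-tuple nat)
  (huv : tamari_interval_diagram u v) :
  synchronized_diagram u v <-> synchronized_interval n (rho (chi huv)).
Proof.
rewrite /rho.
have := epsilon_spec (inhabits Leaf) _ (rho_lower_ex n u v huv).
have := epsilon_spec (inhabits Leaf) _ (rho_upper_ex n u v huv).
move: (epsilon _ _) (epsilon _ _) => s t [st ht] [ss hs].
have hst : tsize s = tsize t by rewrite ss st.
have hs' i j : 0 < i < j -> j <= n -> in_right s i j = (j - i <= letter u i).
  move=> hij jn; have := hs i j; rewrite /= /chi_rel; lia.
have ht' i j : 0 < i < j -> j <= n -> in_left t j i = (j - i <= letter v j).
  move=> hij jn; have := ht i j; rewrite /= /chi_rel; lia.
have [_ _ hc] := huv.
have le : tamari_le s t.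
  apply: tamari_le_of_compatible => // i j h.
  have hb := in_right_bounds _ _ _ h; move: h; rewrite hs' ?ht'; try lia.
  by move=> h; apply/negP => h'; apply: hc; exists i, j; split; lia.
rewrite /synchronized_interval /tamari_interval /= ss st.
split=> [sync | [_ /(canopy_eqP _ _ hst) e] i hi].
- split=> //; apply/canopy_eqP => // i; rewrite st => hi.
  rewrite hs' ?ht'; try lia.
  have := sync i; rewrite addn1 => hi'.
  have : ~ (0 < letter u i /\ 0 < letter v i.+1).
    by case=> h1 h2; apply: hc; exists i, i.+1; split; lia.
  lia.
- have := e i; rewrite st addn1 hs' ?ht'; lia.
Qed.
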